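(* There exists a bounded function $C:(0,\infty)\to(0,\infty)$ such that $\lim_{\alpha\to 0^+}C(\alpha)=4$ and with the following property. Let $n\ge 2$ be an integer, let $\alpha>0$, and let $f:\{-1,1\}^n\to\{-1,1\}$ satisfy $\max_{1\le i<j\le n}I_{i,j}(f)\le \alpha n^{-2}\ln^2 n$. Then $\hat f^{2}(\emptyset)\ge 1-C(\alpha)\alpha$, or there exists exactly one $i\in[n]$ such that $\hat f^{2}(\{i\})\ge 1-C(\alpha)\alpha n^{-1}\ln n$.
   Context: Notation: $[n]=\{1,\dots,n\}$. The discrete cube $\{-1,1\}^n$ carries the uniform probability measure $\mu_n$, with expectation $\mathbb{E}$. For $A\subseteq[n]$, the Walsh function is $w_A(x)=\prod_{i\in A}x_i$ (with $w_\emptyset\equiv 1$), and for $f:\{-1,1\}^n\to\mathbb{R}$ the Walsh-Fourier coefficients are $\hat f(A)=\mathbb{E}[f\cdot w_A]=2^{-n}\sum_{x\in\{-1,1\}^n}f(x)w_A(x)$; $\hat f^2(A)$ means $(\hat f(A))^2$. For distinct $i,j\in[n]$, the influence of the couple $(i,j)$ on $f$ is $I_{i,j}(f)=\sum_{A\subseteq[n]:\, i,j\in A}\hat f^2(A)$. Also, $\ln^2 n=(\ln n)^2$. The function $C$ is universal: it does not depend on $n$ or $f$. *)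

(* Defs.v *)
From HB Require Import structures.
From mathcomp Require Import all_boot all_order all_algebra.
From mathcomp Require Import reals.

Set Implicit Arguments.
Unset Strict Implicit.
Unset Printing Implicit Defensive.

Import GRing.Theory Num.Theory.
Local Open Scope ring_scope.

(* Points of {-1,1}^n are encoded by sign bits: the i-th coordinate of the
   point x is (-1) ^+ x i, so false stands for 1 and true for -1.
   The index set [n] = {1, ..., n} is 'I_n = {0, ..., n-1}. *)
Definition cube (n : nat) : finType := {ffun 'I_n -> bool}.

Definition coord (R : realType) (n : nat) (x : cube n) (i : 'I_n) : R :=
  (-1) ^+ (x i).

Definition expect (R : realType) (n : nat) (g : cube n -> R) : R :=
  (2 ^+ n)^-1 * \sum_(x : cube n) g x.

Definition walsh (R : realType) (n : nat) (A : {set 'I_n}) (x : cube n) : R :=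
  \prod_(i in A) coord R x i.

Definition fourier (R : realType) (n : nat) (f : cube n -> R)
    (A : {set 'I_n}) : R :=
  expect (fun x => f x * walsh R A x).

Definition influence2 (R : realType) (n : nat) (f : cube n -> R)
    (i j : 'I_n) : R :=
  \sum_(A : {set 'I_n} | (i \in A) && (j \in A)) fourier f A ^+ 2.

(* Main.v *)
Require Import Defs.
From HB Require Import structures.
From mathcomp Require Import all_boot all_order all_algebra.
From mathcomp Require Import all_classical all_reals all_analysis.
From mathcomp Require Import zify ring lra.

Set Implicit Arguments.
Unset Strict Implicit.
Unset Printing Implicit Defensive.

Import Order.TTheory GRing.Theory Num.Theory.
Import numFieldNormedType.Exports.
Local Open Scope classical_set_scope.
Local Open Scope ring_scope.

(* For a Boolean f, the part h of f carried by the sets A containing i and j is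
   a second difference, so it is 0 or of absolute value at least 1/2. By
   hypercontractivity the weight of such a small function sits on degrees of
   order ln (1/I_{i,j}), about ln n; counting a set A once per pair (i, j) or
   once per j then gives
     sum_{|A| > 1} f^(A)^2 <= 5/2 alpha,
     sum_{i in A, |A| > 1} f^(A)^2 <= 8/5 alpha ln n / n   for every i,
   as soon as alpha is small. The second bound says that the first difference
   of f in each direction i is nearly constant, hence, having values in
   {-1, 0, 1}, nearly of modulus 1 (f is almost a dictator) or nearly 0. If the
   latter holds for all i, the level-one weight is O(alpha^2) and the first
   bound makes f almost constant. There is enough room to take C = 4 on a whole
   interval (0, e]; for alpha > e, C = 1 / e makes the claim void. *)

(** * Expectation on the cube: linearity, monotonicity, Cauchy-Schwarz *)

Section Expectation.
Context {R : realType} {n : nat}.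
Implicit Types (f g : cube n -> R) (a : R).

Lemma expect_ge0 g : (forall x, 0 <= g x) -> 0 <= expect g.
Proof.
by move=> g0; rewrite mulr_ge0 ?invr_ge0 ?exprn_ge0 //; apply: sumr_ge0.
Qed.

Lemma expectD f g : expect (fun x => f x + g x) = expect f + expect g.
Proof. by rewrite /expect big_split mulrDr. Qed.

Lemma expectZ a g : expect (fun x => a * g x) = a * expect g.
Proof. by rewrite /expect -mulr_sumr mulrCA. Qed.

Lemma expectB f g : expect (fun x => f x - g x) = expect f - expect g.
Proof. by rewrite /expect sumrB mulrBr. Qed.

Lemma expect_sum (I : finType) (P : pred I) (F : I -> cube n -> R) :
  expect (fun x => \sum_(i | P i) F i x) = \sum_(i | P i) expect (F i).
Proof. by rewrite /expect exchange_big /= mulr_sumr. Qed.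

Lemma eq_expect f g : f =1 g -> expect f = expect g.
Proof. by move=> fg; rewrite /expect; congr (_ * _); apply: eq_bigr. Qed.

Lemma ler_expect f g : (forall x, f x <= g x) -> expect f <= expect g.
Proof.
by move=> fg; rewrite -subr_ge0 -expectB; apply: expect_ge0 => x; rewrite subr_ge0.
Qed.

Lemma expect_cst a : expect (fun _ : cube n => a) = a.
Proof.
rewrite /expect sumr_const card_ffun card_bool card_ord -[in X in _ * X]mulr_natl.
by rewrite natrX mulrA mulVf ?mul1r // expf_neq0 // pnatr_eq0.
Qed.

(** The quadratic [t |-> E (f + t g)^2] is nonnegative, which bounds its discriminant. *)
Lemma expect_cauchy_schwarz f g :
  expect (fun x => f x * g x) ^+ 2 <=
  expect (fun x => f x ^+ 2) * expect (fun x => g x ^+ 2).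
Proof.
set F := expect (fun x => f x ^+ 2); set G := expect (fun x => g x ^+ 2).
set b := expect _.
have quad t : 0 <= G * t ^+ 2 + (2 * b) * t + F.
  have -> : G * t ^+ 2 + (2 * b) * t + F = expect (fun x => (f x + t * g x) ^+ 2).
    rewrite (_ : G * t ^+ 2 + (2 * b) * t + F =
      t ^+ 2 * G + (2 * t * b + F)); last by ring.
    rewrite /G /F /b -!expectZ -!expectD; apply: eq_expect => x /=; ring.
  by apply: expect_ge0 => x; rewrite sqr_ge0.
have G0 : 0 <= G by apply: expect_ge0 => x; rewrite sqr_ge0.
have [b0|b0] := eqVneq b 0; first by have := quad 0; rewrite b0; nra.
have [G00|Gn0] := eqVneq G 0.
  (* With [G = 0] the quadratic is affine of slope [2 b != 0]; at this [t] it equals -1, a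
     contradiction. *)
  have := quad (- (F + 1) / (2 * b)); rewrite G00 mul0r add0r mulrCA divff ?mulr1.
    lra.
  by rewrite mulf_neq0 // pnatr_eq0.
(* The quadratic is evaluated at its minimizer [t = - b / G]. *)
rewrite -subr_ge0; have -> : F * G - b ^+ 2 =
  G * (G * (- b / G) ^+ 2 + (2 * b) * (- b / G) + F) by field.
by rewrite mulr_ge0.
Qed.

End Expectation.

(** * Sign change of one coordinate and its effect on Walsh functions *)

Section Flip.
Context {R : realType} {n : nat}.
Implicit Types (g : cube n -> R) (i j : 'I_n) (x : cube n) (A : {set 'I_n}).

Definition flip i x : cube n := [ffun k => (k == i) (+) x k].

Lemma flipE i x k : flip i x k = (k == i) (+) x k.
Proof. by rewrite ffunE. Qed.

Lemma flipK i : involutive (flip i).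
Proof. by move=> x; apply/ffunP => k; rewrite !flipE addbA addbb. Qed.

Lemma expect_flip i g : expect (fun x => g (flip i x)) = expect g.
Proof. by rewrite /expect [in RHS](reindex_inj (inv_inj (flipK i))). Qed.

Lemma walsh_flip A i x : walsh R A (flip i x) = (-1) ^+ (i \in A) * walsh R A x.
Proof.
rewrite /walsh; case: (boolP (i \in A)) => iA.
  rewrite !(big_setD1 i iA) /=. rewrite /Defs.coord flipE eqxx /= mulrA; congr (_ * _).
    by case: (x i) => /=; rewrite ?expr0 ?expr1 ?mulr1 ?mulN1r ?opprK.
  by apply: eq_bigr => k; rewrite !inE => /andP[/negPf ki _]; rewrite flipE ki.
rewrite mul1r; apply: eq_bigr => k kA; rewrite /Defs.coord flipE.
by case: eqP kA => // ->; rewrite (negPf iA).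
Qed.

Lemma sqr_coord x i : Defs.coord R x i ^+ 2 = 1.
Proof. by rewrite /Defs.coord sqrr_sign. Qed.

Lemma sqr_walsh A x : walsh R A x ^+ 2 = 1.
Proof. by rewrite /walsh -prodrXl big1 // => i _; rewrite sqr_coord. Qed.

Lemma walsh_setU1 A i x : i \notin A ->
  walsh R (i |: A)%SET x = Defs.coord R x i * walsh R A x.
Proof. by move=> iA; rewrite /walsh big_setU1. Qed.

End Flip.

(** * Fourier inversion and Parseval's identity *)

Section Fourier.
Context {R : realType} {n : nat}.
Implicit Types (f g : cube n -> R) (c : {set 'I_n} -> R) (A : {set 'I_n}).

Lemma fourierD f g A :
  fourier (fun x => f x + g x) A = fourier f A + fourier g A.
Proof. by rewrite /fourier -expectD; apply: eq_expect => x; rewrite mulrDl. Qed.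

Lemma fourierZ a f A : fourier (fun x => a * f x) A = a * fourier f A.
Proof. by rewrite /fourier -expectZ; apply: eq_expect => x; rewrite mulrA. Qed.

Lemma fourier_flip i f A :
  fourier (fun x => f (flip i x)) A = (-1) ^+ (i \in A) * fourier f A.
Proof.
rewrite /fourier -(expect_flip i (fun x => f x * _)) -expectZ.
by apply: eq_expect => x; rewrite walsh_flip mulrCA signrMK.
Qed.

Lemma expect_walsh_sum g c :
  expect (fun x => g x * \sum_A c A * walsh R A x) = \sum_A c A * fourier g A.
Proof.
rewrite -(eq_bigr _ (fun A _ => expectZ _ _)) -expect_sum; apply: eq_expect => x.
by rewrite mulr_sumr; apply: eq_bigr => A _; rewrite mulrCA.
Qed.

(** The sum over [A] expands the product of the factors [x_i y_i + 1]; a coordinate where [x] and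
    [y] differ makes its factor 0, and otherwise every factor is 2. *)
Lemma walsh_kernel (x y : cube n) :
  \sum_A walsh R A x * walsh R A y = (x == y)%:R * 2 ^+ n.
Proof.
have -> : \sum_A walsh R A x * walsh R A y =
    \prod_(i < n) (Defs.coord R x i * Defs.coord R y i + 1).
  rewrite (bigA_distr 1 +%R); apply: eq_big => [A|A _]; first by rewrite inE.
  by rewrite /walsh -big_split /= big_mkcond.
case: eqP => [->|/eqP xy].
  rewrite mul1r -[in RHS](card_ord n) -prodr_const; apply: eq_bigr => i _.
  by rewrite -expr2 sqr_coord.
have [i xyi] : exists i, x i != y i.
  apply/existsP; apply: contraNT xy => /existsPn xy.
  by apply/eqP/ffunP => i; apply/eqP; move/negPn: (xy i).
rewrite mul0r (bigD1 i) //= /Defs.coord; move: xyi; case: (x i); case: (y i) => // _;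
  by rewrite expr0 expr1 ?mulr1 ?mul1r addNr mul0r.
Qed.

Lemma walsh_inversion g x : g x = \sum_A fourier g A * walsh R A x.
Proof.
have -> : \sum_A fourier g A * walsh R A x =
    (2 ^+ n)^-1 * \sum_y g y * \sum_A walsh R A y * walsh R A x.
  under eq_bigr => A _ do rewrite /fourier /expect -mulrA mulr_suml.
  rewrite -mulr_sumr exchange_big /=; congr (_ * _); apply: eq_bigr => y _.
  by rewrite mulr_sumr; apply: eq_bigr => A _; rewrite mulrA.
rewrite (bigD1 x) //= walsh_kernel eqxx mul1r big1 => [|y yx].
  by rewrite addr0 mulrCA mulVf ?mulr1 // expf_neq0 // pnatr_eq0.
by rewrite walsh_kernel (negPf yx) mul0r mulr0.
Qed.

Lemma parseval g : \sum_A fourier g A ^+ 2 = expect (fun x => g x ^+ 2).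
Proof.
rewrite -(expect_walsh_sum g (fourier g)); apply: eq_expect => x.
by rewrite -walsh_inversion.
Qed.

End Fourier.

(** * Hypercontractivity and the low-degree weight of functions with small support *)

Section Hypercontractivity.
Context {R : realType} {n : nat}.
Implicit Types (g : cube n -> R) (c : {set 'I_n} -> R) (A D : {set 'I_n}).

Lemma sum_subsets_setU1 c D i : i \notin D ->
  \sum_(A : {set 'I_n} | A \subset (i |: D)%SET) c A =
  \sum_(A : {set 'I_n} | A \subset D) c A +
  \sum_(A : {set 'I_n} | A \subset D) c (i |: A)%SET.
Proof.
move=> iD; rewrite (bigID (fun A : {set 'I_n} => i \notin A)) /=.
congr (_ + _).
  by apply: eq_bigl => A; rewrite -subsetD1 finset.setU1K.
rewrite (reindex_onto (fun A => i |: A)%SET (fun A => A :\ i)%SET) /=.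
  apply: eq_bigl => A; rewrite finset.setU11 andbT.
  apply/andP/idP => [[sAD /eqP eA]|sAD].
    by rewrite -eA -(finset.setU1K iD) finset.setSD.
  rewrite finset.setUS // finset.setU1K ?eqxx //.
  by apply: contra iD => /(fintype.subsetP sAD).
by move=> A /andP[_ /negPn iA]; rewrite finset.setD1K.
Qed.

(* A fourth moment E (v + x_i w)^4, with v and w not depending on x_i, equals
   E v^4 + 6 E v^2 w^2 + E w^4 <= (V + 3 W)^2 when E v^4 <= V^2, E w^4 <= W^2. *)
Lemma bonami c D :
  expect (fun x => (\sum_(A : {set 'I_n} | A \subset D) c A * walsh R A x) ^+ 4) <=
  (\sum_(A : {set 'I_n} | A \subset D) 3 ^+ #|A| * c A ^+ 2) ^+ 2.
Proof.
move: {2}#|D| (erefl #|D|) => k; elim: k D c => [|k IH] D c cardD.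
  move/eqP: cardD; rewrite cards_eq0 => /eqP ->.
  have sub0 : (fun A : {set 'I_n} => A \subset finset.set0) =1 pred1 finset.set0.
    by move=> A; rewrite finset.subset0.
  rewrite (eq_bigl _ _ sub0) big_pred1_eq cards0 mul1r -exprM.
  rewrite (@eq_expect _ _ _ (fun=> c finset.set0 ^+ 4)) ?expect_cst //.
  move=> x /=; rewrite (eq_bigl _ _ sub0) big_pred1_eq /walsh big_set0.
  by rewrite mulr1.
have [i iD] : exists i, i \in D by apply/finset.set0Pn; rewrite -card_gt0 cardD.
set D' := (D :\ i)%SET.
have iD' : i \notin D' by rewrite !inE eqxx.
have cardD' : #|D'| = k by move: cardD; rewrite (cardsD1 i) iD => -[].
have notin A : A \subset D' -> i \notin A.
  by move=> sA; apply: contra iD' => /(fintype.subsetP sA).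
rewrite -(finset.setD1K iD) -/D' sum_subsets_setU1 //.
pose v x := \sum_(A : {set 'I_n} | A \subset D') c A * walsh R A x.
pose w x := \sum_(A : {set 'I_n} | A \subset D') c (i |: A)%SET * walsh R A x.
set V := \sum_(A : {set 'I_n} | A \subset D') 3 ^+ #|A| * c A ^+ 2.
set W := \sum_(A : {set 'I_n} | A \subset D') 3 ^+ #|A| * c (i |: A)%SET ^+ 2.
have -> : \sum_(A : {set 'I_n} | A \subset D')
    3 ^+ #|(i |: A)%SET| * c (i |: A)%SET ^+ 2 =
    3 * W :> R.
  rewrite mulr_sumr; apply: eq_bigr => A /notin iA.
  by rewrite cardsU1 iA add1n exprS mulrA.
have flipv x : v (flip i x) = v x.
  by apply: eq_bigr => A /notin iA; rewrite walsh_flip (negPf iA) mul1r.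
have flipw x : w (flip i x) = w x.
  by apply: eq_bigr => A /notin iA; rewrite walsh_flip (negPf iA) mul1r.
have uE x : \sum_(A : {set 'I_n} | A \subset (i |: D')%SET) c A * walsh R A x =
    v x + Defs.coord R x i * w x.
  rewrite sum_subsets_setU1 //; congr (_ + _).
  rewrite mulr_sumr; apply: eq_bigr => A /notin iA.
  by rewrite walsh_setU1 // mulrCA.
have V0 : 0 <= V.
  by apply: sumr_ge0 => A _; rewrite mulr_ge0 ?sqr_ge0 ?exprn_ge0.
have W0 : 0 <= W.
  by apply: sumr_ge0 => A _; rewrite mulr_ge0 ?sqr_ge0 ?exprn_ge0.
have vV : expect (fun x => v x ^+ 4) <= V ^+ 2 by exact: IH.
have wW : expect (fun x => w x ^+ 4) <= W ^+ 2.
  exact: (IH D' (fun A => c (i |: A)%SET)).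
have v0 : 0 <= expect (fun x => v x ^+ 4).
  by apply: expect_ge0 => x; rewrite -[4%N]/(2 * 2)%N exprM sqr_ge0.
have w0 : 0 <= expect (fun x => w x ^+ 4).
  by apply: expect_ge0 => x; rewrite -[4%N]/(2 * 2)%N exprM sqr_ge0.
have vwVW : expect (fun x => v x ^+ 2 * w x ^+ 2) <= V * W.
  have vw0 : 0 <= expect (fun x => v x ^+ 2 * w x ^+ 2).
    by apply: expect_ge0 => x; rewrite mulr_ge0 ?sqr_ge0.
  have VW0 : 0 <= V * W by rewrite mulr_ge0.
  rewrite -(@ler_pXn2r _ 2) ?nnegrE //.
  apply: le_trans (expect_cauchy_schwarz _ _) _.
  rewrite exprMn; under eq_expect => x do rewrite -exprM.
  under [X in _ * X <= _]eq_expect => x do rewrite -exprM.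
  exact: ler_pM.
(* The terms of the fourth power that are odd in [x_i]: flipping [x_i] changes their sign, so their
   mean is 0. *)
pose z x := Defs.coord R x i * (4 * v x ^+ 3 * w x + 4 * v x * w x ^+ 3).
have z0 : expect z = 0.
  have : expect z = - expect z.
    rewrite -[in LHS](expect_flip i) -mulN1r -expectZ; apply: eq_expect => x.
    rewrite /z flipv flipw /Defs.coord flipE eqxx.
    by case: (x i) => /=; rewrite ?expr0 ?expr1; ring.
  lra.
have -> : expect (fun x =>
    (\sum_(A : {set 'I_n} | A \subset (i |: D')%SET) c A * walsh R A x) ^+ 4) =
    expect (fun x => v x ^+ 4) +
    (6 * expect (fun x => v x ^+ 2 * w x ^+ 2) +
     (expect (fun x => w x ^+ 4) + expect z)).
  rewrite -expectZ -!expectD; apply: eq_expect => x; rewrite uE /z.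
  have := sqr_coord (R := R) x i; move: (Defs.coord R x i) => s s1.
  rewrite (_ : (v x + s * w x) ^+ 4 = v x ^+ 4 + 6 * s ^+ 2 * v x ^+ 2 * w x ^+ 2
    + (s ^+ 2) ^+ 2 * w x ^+ 4 + 4 * s * v x ^+ 3 * w x +
    4 * s * s ^+ 2 * v x * w x ^+ 3); last by ring.
  rewrite s1; ring.
rewrite z0; nra.
Qed.

(* Pairing g with its noisy version u = sum_A 3^-|A| g^(A) w_A and using
   Cauchy-Schwarz twice on the support S of g gives, for I = E g^2 and B the
   left-hand side, B^4 <= I^2 P(S) E u^4 <= 4 I^3 B^2. *)
Lemma noise_stability_small_support g (r : R) : 0 <= r ->
  (forall x, g x = 0 \/ 1 <= 4 * g x ^+ 2) ->
  expect (fun x => g x ^+ 2) <= r ^+ 2 ->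
  \sum_(A : {set 'I_n}) 3 ^- #|A| * fourier g A ^+ 2 <=
  2 * r * expect (fun x => g x ^+ 2).
Proof.
move=> r0 gval; set I := expect _ => Ir.
set B := \sum_A _.
pose c (A : {set 'I_n}) : R := 3 ^- #|A| * fourier g A.
pose u x := \sum_A c A * walsh R A x.
pose s x : R := (g x != 0)%:R.
have I0 : 0 <= I by apply: expect_ge0 => x; rewrite sqr_ge0.
have B0 : 0 <= B.
  by apply: sumr_ge0 => A _; rewrite mulr_ge0 ?sqr_ge0 ?invr_ge0 ?exprn_ge0.
have Bgu : B = expect (fun x => g x * (s x * u x)).
  rewrite /B; transitivity (\sum_A c A * fourier g A).
    by apply: eq_bigr => A _; rewrite /c expr2 mulrA.
  rewrite -expect_walsh_sum; apply: eq_expect => x; rewrite -/(u x) /s.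
  by case: eqP => [->|_]; rewrite ?mul0r ?mul1r.
(* The noise rate 1/3 is chosen so that the weight [3 ^+ #|A|] of [bonami] times the squared factor
   [3 ^- #|A|] is again [3 ^- #|A|], which gives back [B]. *)
have u4 : expect (fun x => u x ^+ 4) <= B ^+ 2.
  have := bonami c finset.setT.
  have sT : (fun A : {set 'I_n} => A \subset [set: 'I_n]%SET) =1 xpredT.
    by move=> A; rewrite finset.subsetT.
  rewrite (eq_bigl _ _ sT); under eq_expect => x do rewrite (eq_bigl _ _ sT).
  congr (_ <= _ ^+ 2); apply: eq_bigr => A _.
  rewrite /c exprMn mulrA; congr (_ * _).
  by rewrite [X in _ * X]expr2 mulrA divff ?mul1r // expf_neq0 // pnatr_eq0.
pose Q := expect (fun x => (s x * u x) ^+ 2).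
have Q0 : 0 <= Q by apply: expect_ge0 => x; rewrite sqr_ge0.
have BIQ : B ^+ 2 <= I * Q by rewrite Bgu; exact: expect_cauchy_schwarz.
have QIB : Q ^+ 2 <= 4 * I * B ^+ 2.
  have -> : Q = expect (fun x => s x * u x ^+ 2).
    apply: eq_expect => x; rewrite exprMn /s.
    by case: eqP; rewrite ?expr0n ?expr1n.
  apply: le_trans (expect_cauchy_schwarz _ _) _; apply: ler_pM.
  - by apply: expect_ge0 => x; rewrite sqr_ge0.
  - by apply: expect_ge0 => x; rewrite sqr_ge0.
  (* The support of [g] has probability at most [4 I], since [4 g^2 >= 1] on it. *)
  - rewrite /I -expectZ; apply: ler_expect => x; rewrite /s.
    by case: (gval x) => [->|]; rewrite ?eqxx ?expr0n ?mulr0 //; case: eqP => [->|_];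
      rewrite ?expr0n ?expr1n ?mulr0.
  - by under eq_expect => x do rewrite -exprM.
move: I I0 Ir B B0 Q Q0 BIQ QIB {Bgu u4} => I I0 Ir B B0 Q Q0 BIQ QIB.
have [->|Bn0] := eqVneq B 0; first by rewrite !mulr_ge0.
have Bgt0 : 0 < B by rewrite lt_def Bn0.
have BI : B ^+ 2 <= 4 * I ^+ 3.
  have B2gt0 : 0 < B ^+ 2 by rewrite exprn_gt0.
  rewrite -(ler_pM2r B2gt0).
  have : (B ^+ 2) ^+ 2 <= (I * Q) ^+ 2.
    by rewrite ler_pXn2r ?nnegrE ?mulr_ge0 // ?exprn_ge0.
  rewrite [X in _ <= X -> _]exprMn => BB; apply: le_trans BB _.
  apply: le_trans (ler_wpM2l (sqr_ge0 I) QIB) _.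
  by rewrite le_eqVlt; apply/orP; left; apply/eqP; ring.
rewrite -(@ler_pXn2r _ 2) ?nnegrE ?mulr_ge0 //.
apply: le_trans BI _; rewrite !exprMn.
have := ler_wpM2l (sqr_ge0 I) Ir; nra.
Qed.

(** From degree [K] on, [phi] is at most [a]; below it, [phi <= 1 <= 3^K 3^-|A|], and the noise
    stability bound applies. *)
Lemma truncated_weight_le g (r a : R) (phi : nat -> R) K : 0 <= r -> 0 <= a ->
  (forall x, g x = 0 \/ 1 <= 4 * g x ^+ 2) ->
  expect (fun x => g x ^+ 2) <= r ^+ 2 ->
  (forall k, phi k <= 1) -> (forall k, (K <= k)%N -> phi k <= a) ->
  \sum_(A : {set 'I_n}) phi #|A| * fourier g A ^+ 2 <=
  (a + 3 ^+ K * (2 * r)) * r ^+ 2.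
Proof.
move=> r0 a0 gval Ir phi1 phia.
have := noise_stability_small_support r0 gval Ir; have := parseval g.
set I := expect _ => sumI sumB.
apply: (@le_trans _ _ ((a + 3 ^+ K * (2 * r)) * I)); last first.
  by rewrite ler_wpM2l // addr_ge0 // !mulr_ge0 // exprn_ge0.
apply: (@le_trans _ _ (a * I +
    3 ^+ K * \sum_(A : {set 'I_n}) 3 ^- #|A| * fourier g A ^+ 2)); last first.
  by rewrite mulrDl lerD2l -[leRHS]mulrA ler_wpM2l ?exprn_ge0.
rewrite -sumI !mulr_sumr -big_split /=; apply: ler_sum => A _.
rewrite mulrA -mulrDl ler_wpM2r ?sqr_ge0 //.
have [KA|AK] := leqP K #|A|.
  by rewrite (le_trans (phia _ KA)) // lerDl mulr_ge0 ?invr_ge0 ?exprn_ge0.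
rewrite (le_trans (phi1 _)) // -[leLHS]add0r lerD //.
by rewrite -(subnK (ltnW AK)) exprD mulfK ?expf_neq0 ?pnatr_eq0 // exprn_ege1 ?ler1n.
Qed.

End Hypercontractivity.

(** * Discrete derivatives, pair influences and Fourier weights *)

Section Influence.
Context {R : realType} {n : nat}.
Implicit Types (f : cube n -> R) (i j : 'I_n) (A : {set 'I_n}).

(** The discrete derivative times [x_i]. The difference is written as a sum with a scalar -1 so that
    [fourierD] and [fourierZ] apply directly. *)
Definition diff i f (x : cube n) : R := 2^-1 * (f x + (-1) * f (flip i x)).

Lemma fourier_diff i f A : fourier (diff i f) A = (i \in A)%:R * fourier f A.
Proof.
rewrite /diff fourierZ fourierD fourierZ fourier_flip.
by case: (i \in A); rewrite /= ?expr0 ?expr1; lra.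
Qed.

Lemma diff_norm i f (x : cube n) : (forall x, f x = -1 \/ f x = 1) ->
  [\/ diff i f x = 0, diff i f x = 1 | diff i f x = -1].
Proof.
move=> fb; rewrite /diff; case: (fb x) => ->; case: (fb (flip i x)) => ->;
  [apply: Or31|apply: Or33|apply: Or32|apply: Or31]; lra.
Qed.

Lemma diff2_norm i j f (x : cube n) : (forall x, f x = -1 \/ f x = 1) ->
  diff i (diff j f) x = 0 \/ 1 <= 4 * diff i (diff j f) x ^+ 2.
Proof.
move=> fb; rewrite [diff i _ _]/diff.
case: (diff_norm j x fb) => ->; case: (diff_norm j (flip i x) fb) => ->;
  try (by left; lra); right; nra.
Qed.

Lemma influence2C f i j : influence2 f i j = influence2 f j i.
Proof. by rewrite /influence2; apply: eq_bigl => A; rewrite andbC. Qed.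

(** The function [diff i (diff j f)] keeps the coefficients of [f] at the sets containing [i] and
    [j] and kills the others, so [truncated_weight_le] applies to it. *)
Lemma pair_weight_le f i j (r a : R) (phi : nat -> R) K :
  (forall x, f x = -1 \/ f x = 1) -> 0 <= r -> 0 <= a ->
  influence2 f i j <= r ^+ 2 ->
  (forall k, phi k <= 1) -> (forall k, (K <= k)%N -> phi k <= a) ->
  \sum_(A : {set 'I_n} | (i \in A) && (j \in A)) phi #|A| * fourier f A ^+ 2 <=
  (a + 3 ^+ K * (2 * r)) * r ^+ 2.
Proof.
move=> fb r0 a0 Iij phi1 phia.
have fE A : fourier (diff i (diff j f)) A ^+ 2 =
    if (i \in A) && (j \in A) then fourier f A ^+ 2 else 0.
  rewrite !fourier_diff; case: (i \in A); case: (j \in A);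
    by rewrite ?mul1r ?mul0r ?expr0n.
have Ir : expect (fun x => diff i (diff j f) x ^+ 2) <= r ^+ 2.
  by rewrite -parseval (eq_bigr _ (fun A _ => fE A)) -big_mkcond.
have := truncated_weight_le r0 a0 (fun x => diff2_norm i j x fb) Ir phi1 phia.
congr (_ <= _); rewrite [RHS]big_mkcond; apply: eq_bigr => A _; rewrite fE.
by case: ifP; rewrite ?mulr0.
Qed.

(** Summing the pair bound over [j != i] counts each set [A] containing [i] exactly [|A| - 1]
    times. *)
Lemma vertex_weight_le f i (r a : R) (phi : nat -> R) K :
  (forall x, f x = -1 \/ f x = 1) -> 0 <= r -> 0 <= a ->
  (forall j, j != i -> influence2 f i j <= r ^+ 2) ->
  (forall k, phi k <= 1) -> (forall k, (K <= k)%N -> phi k <= a) ->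
  \sum_(A : {set 'I_n} | i \in A) #|A|.-1%:R * phi #|A| * fourier f A ^+ 2 <=
  n%:R * ((a + 3 ^+ K * (2 * r)) * r ^+ 2).
Proof.
move=> fb r0 a0 Ii phi1 phia.
have -> : \sum_(A : {set 'I_n} | i \in A) #|A|.-1%:R * phi #|A| * fourier f A ^+ 2
    = \sum_(j | j != i) \sum_(A : {set 'I_n} | (i \in A) && (j \in A))
        phi #|A| * fourier f A ^+ 2.
  under [RHS]eq_bigr => j _ do rewrite big_mkcondr.
  rewrite exchange_big /=; apply: eq_bigr => A iA; rewrite -big_mkcondr /=.
  rewrite sumr_const -mulrA -[RHS]mulr_natl; congr (_%:R * _).
  rewrite (cardsD1 i A) iA add1n /= -cardsE; apply: eq_card => j.
  by rewrite !inE.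
apply: (@le_trans _ _ (\sum_(j : 'I_n | j != i)
    (a + 3 ^+ K * (2 * r)) * r ^+ 2)).
  by apply: ler_sum => j ji; apply: pair_weight_le => //; exact: Ii.
rewrite sumr_const -[leLHS]mulr_natl ler_wpM2r ?ler_nat //.
  by rewrite mulr_ge0 ?sqr_ge0 // addr_ge0 // !mulr_ge0 // exprn_ge0.
by rewrite -[X in (_ <= X)%N]card_ord max_card.
Qed.

Lemma vertex_weight_split f i :
  \sum_(A : {set 'I_n} | i \in A) fourier f A ^+ 2 = fourier f [set i]%SET ^+ 2 +
  \sum_(A : {set 'I_n} | (i \in A) && (1 < #|A|)%N) fourier f A ^+ 2.
Proof.
rewrite (bigD1 [set i]%SET) ?inE //=; congr (_ + _); apply: eq_bigl => A.
case: (boolP (i \in A)) => //= iA; rewrite eq_sym eqEcard finset.sub1set iA cards1 /=.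
by rewrite -ltnNge.
Qed.

Lemma parseval_levels f : (forall x, f x = -1 \/ f x = 1) ->
  1 = fourier f finset.set0 ^+ 2 + \sum_i fourier f [set i]%SET ^+ 2 +
      \sum_(A : {set 'I_n} | (1 < #|A|)%N) fourier f A ^+ 2.
Proof.
move=> fb; have := parseval f.
rewrite (@eq_expect _ _ _ (fun=> 1)) => [|x]; last first.
  by case: (fb x) => ->; rewrite ?sqrrN expr1n.
rewrite expect_cst => <-.
rewrite (bigID (fun A : {set 'I_n} => (1 < #|A|)%N)) /= addrC; congr (_ + _).
rewrite (bigD1 finset.set0) /= ?cards0 //; congr (_ + _).
rewrite (eq_bigl (fun A : {set 'I_n} => #|A| == 1%N)); last first.
  move=> A; rewrite -leqNgt -cards_eq0; by case: #|A| => [|[|]].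
rewrite (eq_bigl [in [set [set i] | i in 'I_n]%SET]) => [|A].
  rewrite big_imset //= => i j _ _; exact: finset.set1_inj.
apply/cards1P/imsetP => [[i ->]|[i _ ->]]; by exists i.
Qed.

(** The coefficient is the mean of [diff i f] times a sign, and [|diff i f| = (diff i f)^2] because
    the values are -1, 0 and 1. *)
Lemma sqr_fourier1_le f i : (forall x, f x = -1 \/ f x = 1) ->
  fourier f [set i]%SET ^+ 2 <=
  (\sum_(A : {set 'I_n} | i \in A) fourier f A ^+ 2) ^+ 2.
Proof.
move=> fb.
have -> : \sum_(A : {set 'I_n} | i \in A) fourier f A ^+ 2 =
    expect (fun x => diff i f x ^+ 2).
  rewrite -parseval big_mkcond; apply: eq_bigr => A _; rewrite fourier_diff.
  by case: ifP; rewrite ?mul1r ?mul0r ?expr0n.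
have -> : fourier f [set i]%SET = fourier (diff i f) [set i]%SET.
  by rewrite fourier_diff inE eqxx mul1r.
have d2_ge (x : cube n) : diff i f x * walsh R [set i]%SET x <= diff i f x ^+ 2 /\
    - diff i f x ^+ 2 <= diff i f x * walsh R [set i]%SET x.
  have : walsh R [set i]%SET x ^+ 2 = 1 by exact: sqr_walsh.
  by case: (diff_norm i x fb) => ->; nra.
have ub : fourier (diff i f) [set i]%SET <= expect (fun x => diff i f x ^+ 2).
  by apply: ler_expect => x; case: (d2_ge x).
have lb : - expect (fun x => diff i f x ^+ 2) <= fourier (diff i f) [set i]%SET.
  rewrite -mulN1r -expectZ; apply: ler_expect => x; rewrite mulN1r.
  by case: (d2_ge x).
nra.
Qed.

End Influence.

(** * Numerical estimates for powers and logarithms *)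

Lemma cube_geometric_bound m : (m.+1 ^ 3 * 3 ^ m <= 128 * 4 ^ m)%N.
Proof.
have [|m9] := leqP m 9.
  by do 10 (case: m => [|m]; first by lia).
rewrite -(subnK (ltnW m9)); elim: (m - 9)%N => [|k IH]; first by lia.
rewrite addSn; move: (k + 9)%N (leq_addl k 9) IH => {m9 k} m m9.
(* The induction step compares consecutive ratios; [m = 9] is the first value at which this holds
   (3993 against 4000). *)
have : (3 * m.+2 ^ 3 <= 4 * m.+1 ^ 3)%N.
  by move: m9; rewrite !expnS !expn0; nia.
rewrite [(3 ^ m.+1)%N]expnS [(4 ^ m.+1)%N]expnS.
by move: (3 ^ m)%N (4 ^ m)%N (m.+2 ^ 3)%N (m.+1 ^ 3)%N => a b c d; nia.
Qed.

Section Logarithm.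
Context {R : realType}.

Lemma ln_trunc_log_le n : (0 < n)%N ->
  ln (n%:R : R) <= 3 / 2 * (trunc_log 4 n).+1%:R.
Proof.
move=> n0; have /andP[_ /ltnW nlt] := trunc_log_bounds (isT : (1 < 4)%N) n0.
set M := (trunc_log 4 n).+1 in nlt *.
(* ln 4 <= 3 / 2, since 4 <= 1.15 ^ 10 and ln 1.15 <= 0.15 *)
have q0 : (0 : R) < 1 + 3 / 20 by lra.
have nq : n%:R <= ((1 + 3 / 20) ^+ 10) ^+ M :> R.
  apply: (@le_trans _ _ ((4 ^ M)%N%:R)); first by rewrite ler_nat.
  rewrite natrX ler_pXn2r ?nnegrE ?exprn_ge0 ?(ltW q0) //; lra.
apply: (@le_trans _ _ (ln (((1 + 3 / 20) ^+ 10) ^+ M))).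
  by rewrite ler_ln ?posrE ?exprn_gt0 ?ltr0n.
rewrite lnXn ?exprn_gt0 // lnXn //.
have : ln (1 + 3 / 20 : R) <= 3 / 20 by apply: le_ln1Dx; lra.
move: (ln _) => l l_le; rewrite -[leLHS]mulr_natr ler_wpM2r //; lra.
Qed.

(** Abstracts [s = sqrt alpha], [L = ln n], [T = 3^m], [M = m + 1], [N = n]. The main terms
    contribute the factors 3/2 and 9/4, and each error term at most 1/10. *)
Lemma weight_bounds_arith (s L T M N : R) : 0 <= s -> s <= 1000^-1 ^+ 2 ->
  0 <= L -> 0 < N -> 0 <= T -> 1 <= M -> M ^+ 3 * T <= 128 * N -> L <= 3 / 2 * M ->
  N * ((M^-1 + 3 * (3 * T) * (2 * (s * L / N))) * (s * L / N) ^+ 2) <=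
    8 / 5 * (s ^+ 2 * N^-1 * L) /\
  N * (N * ((((M + 1) * M)^-1 + 3 * (3 * T) * (2 * (s * L / N))) *
    (s * L / N) ^+ 2)) <= 5 / 2 * s ^+ 2.
Proof.
move=> s0 s_small L0 N0 T0 M1 MT Lle.
have M0 : 0 < M by lra.
have L2 : L ^+ 2 <= 9 / 4 * M ^+ 2.
  rewrite (_ : 9 / 4 * M ^+ 2 = (3 / 2 * M) ^+ 2); last by field.
  by rewrite ler_pXn2r ?nnegrE // mulr_ge0 ?(ltW M0) //; lra.
have L3 : L ^+ 3 <= 27 / 8 * M ^+ 3.
  rewrite (_ : 27 / 8 * M ^+ 3 = (3 / 2 * M) ^+ 3); last by field.
  by rewrite ler_pXn2r ?nnegrE // mulr_ge0 ?(ltW M0) //; lra.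
have M23 : M ^+ 2 <= M ^+ 3 by rewrite ler_weXn2l.
have TL3 : T * L ^+ 3 <= 432 * N.
  have := ler_wpM2l T0 L3; lra.
have TL2 : T * L ^+ 2 <= 432 * N.
  have := ler_wpM2l T0 L2; have := ler_wpM2l T0 M23; nra.
(* Here 432 is [128 * 27/8] and 18 is [3 * 3 * 2]; smallness of [s] absorbs both. *)
have err k : T * L ^+ k <= 432 * N -> 18 * s * (T * L ^+ k / N) <= 1 / 10.
  move=> TLk; have : T * L ^+ k / N <= 432 by rewrite ler_pdivrMr.
  have : 0 <= T * L ^+ k / N by rewrite divr_ge0 ?mulr_ge0 ?exprn_ge0 // ltW.
  move: (_ / N) => z z0 z_le.
  have : s * z <= 1000^-1 ^+ 2 * 432 by rewrite ler_pM.
  lra.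
have LM : L / M <= 3 / 2 by rewrite ler_pdivrMr.
have LM2 : L ^+ 2 / ((M + 1) * M) <= 9 / 4.
  have MM : 0 < (M + 1) * M by rewrite mulr_gt0 // addr_gt0.
  by rewrite ler_pdivrMr //; nra.
split.
  rewrite (_ : N * _ = (s ^+ 2 * N^-1 * L) * (L / M + 18 * s * (T * L ^+ 2 / N))).
    rewrite [leRHS]mulrC ler_wpM2l //.
      by rewrite !mulr_ge0 ?invr_ge0 ?sqr_ge0 // ltW.
    have := err 2 TL2; lra.
  field; apply/andP; split; lra.
rewrite (_ : N * _ = s ^+ 2 * (L ^+ 2 / ((M + 1) * M) + 18 * s * (T * L ^+ 3 / N))).
  rewrite [leRHS]mulrC ler_wpM2l ?sqr_ge0 //; have := err 3 TL3; lra.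
field; apply/and3P; split; lra.
Qed.

(* The cut-off degree m + 2 with m = log_4 n balances the two error terms. *)
Lemma weight_bounds n (alpha : R) (m := trunc_log 4 n)
    (r := Num.sqrt alpha * ln (n%:R : R) / n%:R) :
  (2 <= n)%N -> 0 < alpha -> alpha <= (1000^-1 ^+ 2) ^+ 2 ->
  n%:R * ((m.+1%:R^-1 + 3 ^+ m.+2 * (2 * r)) * r ^+ 2) <=
    8 / 5 * (alpha * n%:R^-1 * ln (n%:R : R)) /\
  n%:R * (n%:R * (((m.+2 * m.+1)%N%:R^-1 + 3 ^+ m.+2 * (2 * r)) * r ^+ 2)) <=
    5 / 2 * alpha.
Proof.
move=> n2 a0 a_small; have n0 : (0 < n)%N by exact: ltn_trans n2.
have s2 : Num.sqrt alpha ^+ 2 = alpha by rewrite sqr_sqrtr // ltW.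
have s_small : Num.sqrt alpha <= 1000^-1 ^+ 2.
  rewrite -(@ler_pXn2r _ 2) ?nnegrE ?sqrtr_ge0 ?sqr_ge0 // s2.
  exact: a_small.
rewrite natrM (_ : m.+2%:R = m.+1%:R + 1 :> R); last by rewrite -natr1.
rewrite [3 ^+ m.+2]exprS [3 ^+ m.+1]exprS.
rewrite -[X in 8 / 5 * (X * _ * _)]s2 -[X in 5 / 2 * X]s2.
apply: weight_bounds_arith s_small _ _ _ _ _ _.
- exact: sqrtr_ge0.
- by rewrite ln_ge0 // ler1n.
- by rewrite ltr0n.
- by rewrite exprn_ge0.
- by rewrite ler1n.
- have /andP[nge _] := trunc_log_bounds (isT : (1 < 4)%N) n0.
  rewrite -!natrX -!natrM ler_nat (leq_trans (cube_geometric_bound m)) //.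
  by rewrite leq_mul2l nge.
- exact: ln_trunc_log_le.
Qed.

(** Apply [ln y <= y] to [y = sqrt x]. This makes a sum of [n] terms of order [(alpha ln n / n)^2]
    of order [alpha^2]. *)
Lemma sqr_ln_le (x : R) : 1 <= x -> ln x ^+ 2 <= 4 * x.
Proof.
move=> x1; have x0 : 0 < x by exact: lt_le_trans x1.
have y0 : 0 < Num.sqrt x by rewrite sqrtr_gt0.
rewrite -[in leRHS](sqr_sqrtr (ltW x0)).
have : ln x = 2 * ln (Num.sqrt x).
  by rewrite -[in LHS](sqr_sqrtr (ltW x0)) lnXn // mulr_natl.
have := ln_sublinear y0; have := ln_ge0 x1.
by move: (@ln R x) (@ln R _) (Num.sqrt x) y0 => l k y y0 l0 ky lE; nra.
Qed.

End Logarithm.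

(** * Boolean functions with small pair influences and small [alpha] *)

Section SmallSecondOrderInfluences.
Context {R : realType} {n : nat}.
Variables (alpha : R) (f : cube n -> R).
Hypotheses (n2 : (2 <= n)%N) (a0 : 0 < alpha) (a_small : alpha <= (1000^-1 ^+ 2) ^+ 2).
Hypothesis fb : forall x, f x = -1 \/ f x = 1.
Hypothesis f_infl : forall i j : 'I_n, (i < j)%N ->
  influence2 f i j <= alpha * (n%:R ^+ 2)^-1 * ln (n%:R : R) ^+ 2.

Let m := trunc_log 4 n.
Let r : R := Num.sqrt alpha * ln (n%:R : R) / n%:R.

Let r_ge0 : 0 <= r.
Proof.
by rewrite /r !mulr_ge0 ?sqrtr_ge0 ?invr_ge0 ?ln_ge0 // ler1n (ltn_trans _ n2).
Qed.

Let influence2_le i j : j != i -> influence2 f i j <= r ^+ 2.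
Proof.
have -> : r ^+ 2 = alpha * (n%:R ^+ 2)^-1 * ln (n%:R : R) ^+ 2.
  by rewrite /r !exprMn sqr_sqrtr ?ltW // exprVn mulrAC.
by rewrite -val_eqE neq_ltn => /orP[|] ij; [rewrite influence2C|]; exact: f_infl.
Qed.

Let invn_le1 k : k%:R^-1 <= 1 :> R.
Proof. by case: k => [|k]; rewrite ?invr0 // invf_le1 ?ltr0n // ler1n. Qed.

Lemma vertex_high_weight i :
  \sum_(A : {set 'I_n} | (i \in A) && (1 < #|A|)%N) fourier f A ^+ 2 <=
  8 / 5 * (alpha * n%:R^-1 * ln (n%:R : R)).
Proof.
apply: le_trans (proj1 (weight_bounds n2 a0 a_small)); rewrite -/m -/r.
(* Cancels the multiplicity [|A| - 1]; for [k <= 1] the value is the inverse of 0, which is 0. *)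
pose phi (k : nat) : R := k.-1%:R^-1.
apply: (@le_trans _ _ (\sum_(A : {set 'I_n} | i \in A)
    #|A|.-1%:R * phi #|A| * fourier f A ^+ 2)).
  rewrite big_mkcondr; apply: ler_sum => A _; rewrite /phi.
  by case: #|A| => [|[|k]] /=; rewrite ?mul0r // divff ?mul1r // pnatr_eq0.
apply: vertex_weight_le => //.
- by move=> j; exact: influence2_le.
- by move=> k; exact: invn_le1.
- by case=> [|[|k]] // mk; rewrite /phi lef_pV2 ?posrE ?ltr0n // ler_nat.
Qed.

Lemma total_high_weight :
  \sum_(A : {set 'I_n} | (1 < #|A|)%N) fourier f A ^+ 2 <= 5 / 2 * alpha.
Proof.
apply: le_trans (proj2 (weight_bounds n2 a0 a_small)); rewrite -/m -/r.
(* Summing over [i] as well counts each [A] with multiplicity [|A| (|A| - 1)], which this [phi]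
   cancels. *)
pose phi (k : nat) : R := (k * k.-1)%N%:R^-1.
apply: (@le_trans _ _ (\sum_(i < n) \sum_(A : {set 'I_n} | i \in A)
   #|A|.-1%:R * phi #|A| * fourier f A ^+ 2)); last first.
  set K := (X in _ <= _ * X); apply: (@le_trans _ _ (\sum_(i < n) K)).
    apply: ler_sum => i _; apply: vertex_weight_le => //.
    - by move=> j; exact: influence2_le.
    - by move=> k; exact: invn_le1.
    - case=> [|[|k]] // mk; rewrite /phi lef_pV2 ?posrE ?ltr0n // ler_nat.
      by rewrite leq_mul.
  by rewrite sumr_const card_ord mulr_natl.
rewrite (exchange_big_dep xpredT) //= big_mkcond; apply: ler_sum => A _.
rewrite sumr_const -[leRHS]mulr_natl mulrA [_ * (_ * phi _)]mulrA.
rewrite /phi; case: #|A| => [|[|k]] //=; rewrite ?mul0r ?mulr0 ?mul0r //.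
by rewrite -natrM divff ?mul1r // pnatr_eq0.
Qed.

(* The derivative of f in direction i has values in {-1, 0, 1}, so with
   p = P(it is nonzero), its mean a_i = f^({i}) satisfies |a_i| <= p and its
   variance p - a_i^2 is the weight of the sets A of size > 1 containing i.
   Hence p (1 - p) is tiny for all i: either some p is close to 1, or all of
   them are close to 0 and then sum_i a_i^2 <= sum_i p^2 is negligible. *)
Lemma near_constant_or_dictator :
  1 - 4 * alpha <= fourier f finset.set0 ^+ 2 \/
  exists! i, 1 - 4 * alpha * n%:R^-1 * ln (n%:R : R) <= fourier f [set i]%SET ^+ 2.
Proof.
set d := alpha * n%:R^-1 * ln (n%:R : R).
have -> : 4 * alpha * n%:R^-1 * ln (n%:R : R) = 4 * d by rewrite /d !mulrA.
pose p i := \sum_(A : {set 'I_n} | i \in A) fourier f A ^+ 2.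
have n0 : (0 < n)%N by exact: ltn_trans n2.
have N0 : (0 : R) < n%:R by rewrite ltr0n.
have LN : ln (n%:R : R) <= n%:R by exact/ltW/ln_sublinear.
have LN2 : ln (n%:R : R) ^+ 2 <= 4 * n%:R by rewrite sqr_ln_le // ler1n.
have L0 : 0 <= ln (n%:R : R) by rewrite ln_ge0 // ler1n.
have d0 : 0 <= d by rewrite /d !mulr_ge0 ?invr_ge0 // ltW.
have d_a : d <= alpha.
  rewrite /d -mulrA -[leRHS]mulr1 ler_wpM2l ?(ltW a0) //.
  by rewrite mulrC ler_pdivrMr // mul1r.
have Nd : n%:R * d ^+ 2 <= 4 * alpha ^+ 2.
  have -> : n%:R * d ^+ 2 = alpha ^+ 2 * (ln (n%:R : R) ^+ 2 / n%:R).
    by rewrite /d; field; rewrite pnatr_eq0 -lt0n.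
  by rewrite mulrC ler_wpM2r ?sqr_ge0 // ler_pdivrMr.
have a_tiny : 1000 * alpha <= 1 by move: a_small; lra.
have tot := parseval_levels fb.
have high : 0 <= \sum_(A : {set 'I_n} | (1 < #|A|)%N) fourier f A ^+ 2.
  by apply: sumr_ge0 => A _; exact: sqr_ge0.
have pd i : p i - fourier f [set i]%SET ^+ 2 <= 8 / 5 * d.
  by rewrite /p vertex_weight_split addrC addKr; exact: vertex_high_weight.
have ap i : fourier f [set i]%SET ^+ 2 <= p i ^+ 2 by exact: sqr_fourier1_le.
have p0 i : 0 <= p i by apply: sumr_ge0 => A _; exact: sqr_ge0.
have [[i pi]|small] : (exists i, 1 / 2 < p i) \/ forall i, p i <= 1 / 2.
  have [/existsP[i pi]|/existsPn small] := boolP [exists i, 1 / 2 < p i].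
    by left; exists i.
  by right=> i; rewrite leNgt.
(* From [q > 1/2] alone, [1 - q <= 16/5 d], which would only give the constant 24/5. But it forces
   [q >= 99/100], and a second pass with this bound brings the constant below 4. *)
- have ai : 1 - 4 * d <= fourier f [set i]%SET ^+ 2.
    move: (pd i) (ap i); move: (p i) (_ ^+ 2) pi => q b pi pd_i ap_i.
    have [q1|q1] := leP 1 q; first by lra.
    have q2 : 1 - q <= 16 / 5 * d by nra.
    have q3 : 99 / 100 <= q by lra.
    have q4 : (1 - q) * (99 / 100) <= 8 / 5 * d by nra.
    lra.
  (* Two such indices would carry weight at least [2 - 8 d > 1], against Parseval. *)
  right; exists i; split=> // j aj.
  apply/eqP; apply: contraT => ij; move: tot.
  rewrite (bigD1 i) //= (bigD1 j) ?[j == i]eq_sym //=.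
  set rest := (X in _ + (_ + (_ + X)) + _).
  have rest0 : 0 <= rest by apply: sumr_ge0 => k _; exact: sqr_ge0.
  have := sqr_ge0 (fourier f finset.set0).
  lra.
- left; have := total_high_weight.
  (* Here [p i <= 16/5 d], whose square is at most [11 d^2]; summing over [i] gives at most
     [44 alpha^2]. Together with [5/2 alpha] from the higher levels this stays below [4 alpha]. *)
  have W1 : \sum_i fourier f [set i]%SET ^+ 2 <= 50 * alpha ^+ 2.
    apply: (@le_trans _ _ (\sum_(i < n) 11 * d ^+ 2)).
      apply: ler_sum => i _; have := pd i; have := ap i; have := small i.
      move: (p i) (p0 i) (fourier f _ ^+ 2) => q q0 b q2 bq qb.
      have q3 : q <= 16 / 5 * d by nra.
      nra.
    rewrite sumr_const card_ord -[leLHS]mulr_natl mulrCA; have := sqr_ge0 alpha.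
    lra.
  nra.
Qed.

End SmallSecondOrderInfluences.

(** * The choice of [C] and the passage to all [alpha > 0] *)

Theorem theorem2p2 (R : realType) :
  exists C : R -> R,
    (forall a : R, 0 < a -> 0 < C a) /\
    (exists M : R, forall a : R, 0 < a -> C a <= M) /\
    (C a @[a --> (0 : R)^'+] --> (4 : R)) /\
    forall (n : nat) (alpha : R) (f : cube n -> R),
      (2 <= n)%N ->
      0 < alpha ->
      (forall x : cube n, f x = -1 \/ f x = 1) ->
      (forall i j : 'I_n, (i < j)%N ->
         influence2 f i j <= alpha * (n%:R ^+ 2)^-1 * ln (n%:R : R) ^+ 2) ->
      1 - C alpha * alpha <= fourier f finset.set0 ^+ 2 \/
      exists! i : 'I_n,
        1 - C alpha * alpha * (n%:R)^-1 * ln (n%:R : R)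
          <= fourier f [set i]%SET ^+ 2.
Proof.
(* The threshold is kept opaque: only its positivity and this upper bound are used. *)
have [e e0 e_small] : exists2 e : R, 0 < e & e <= (1000^-1 ^+ 2) ^+ 2.
  by exists ((1000^-1 ^+ 2) ^+ 2); [lra|exact: lexx].
exists (fun a => if a <= e then 4 else e^-1); split=> [a _|].
  by case: ifP; rewrite ?invr_gt0.
split.
  exists (4 + e^-1) => a _; case: ifP => _; rewrite ?lerDl ?lerDr //.
  by rewrite invr_ge0 ltW.
split.
  apply: cvg_near_cst; near=> a; rewrite ifT //.
  by apply/ltW; near: a; exact: nbhs_right_lt.
move=> n alpha f n2 a0 fb f_infl; case: (leP alpha e) => [ae|/ltW ea]; last first.
  left; apply: le_trans (sqr_ge0 _); rewrite subr_le0 mulrC.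
  by rewrite ler_pdivlMr // mul1r.
have {}ae := le_trans ae e_small.
exact: (near_constant_or_dictator n2 a0 ae fb f_infl).
Unshelve. all: by end_near.
Qed.
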